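(* Let $G$ be a finite group. The property of conjugate invariance of functions $f:G\to\mathbb{D}$ (that is, $f(yxy^{-1})=f(x)$ for all $x,y\in G$) has a one-sided error tester with query complexity $O(1/\epsilon^2)$, where the constant in the $O(\cdot)$ does not depend on $G$.
   Context: $\mathbb{D}=\{z\in\mathbb{C}: |z|\le 1\}$. For $f,g:G\to\mathbb{D}$, $\mathrm{dist}(f,g)=\frac12\|f-g\|_2$ with $\|h\|_2=\sqrt{\mathbf{E}_{x\in G}|h(x)|^2}$ ($x$ uniform in $G$). A function $f$ is $\epsilon$-far from a property $\mathcal{P}$ if $\mathrm{dist}(f,g)\ge\epsilon$ for every $g:G\to\mathbb{D}$ satisfying $\mathcal{P}$. A tester for $\mathcal{P}$ is a randomized algorithm that, given $\epsilon>0$ and query access to $f:G\to\mathbb{D}$ (it may sample uniform elements of $G$ and perform group operations), accepts with probability at least $2/3$ if $f$ satisfies $\mathcal{P}$ and rejects with probability at least $2/3$ if $f$ is $\epsilon$-far from $\mathcal{P}$. It is one-sided error if it accepts with probability $1$ whenever $f$ satisfies $\mathcal{P}$. The query complexity is the number of queries to $f$. *)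

(* Defs.v *)
From mathcomp Require Import all_boot all_order all_algebra all_fingroup.
From mathcomp Require Import complex reals.

Set Implicit Arguments.
Unset Strict Implicit.
Unset Printing Implicit Defensive.

Import Order.TTheory GRing.Theory Num.Theory.

Local Open Scope ring_scope.

Definition disc (R : realType) : Type := {z : R[i] | Normc.normc z <= 1}.

Definition expect (R : realType) (G : finGroupType) (h : G -> R) : R :=
  #|G|%:R^-1 * \sum_(x : G) h x.

Definition l2norm (R : realType) (G : finGroupType) (h : G -> R[i]) : R :=
  Num.sqrt (expect (fun x => Normc.normc (h x) ^+ 2)).

Definition dist (R : realType) (G : finGroupType) (f g : G -> disc R) : R :=
  2^-1 * l2norm (fun x => val (f x) - val (g x)).

Definition far_from (R : realType) (G : finGroupType)
    (P : (G -> disc R) -> Prop) (eps : R) (f : G -> disc R) : Prop :=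
  forall g : G -> disc R, P g -> eps <= dist f g.

Definition conjugate_invariant (R : realType) (G : finGroupType)
    (f : G -> disc R) : Prop :=
  forall x y : G, f (y * x * y^-1)%g = f x.

(* An adaptive randomized algorithm whose queries have answers in A, given as
   a decision tree.  It sees group elements only through handles: the machine
   keeps a stack of group elements, each of [Sample], [One], [Mul i j] and
   [Inv i] pushes its result on top, and i, j are positions counted from the
   top.  Positions outside the stack denote the identity.  [Return true] means
   acceptance. *)
Inductive algorithm (A : Type) : Type :=
  | Return of bool
  | Flip of bool -> algorithm A
  | Sample of algorithm A
  | One of algorithm A
  | Mul of nat & nat & algorithm A
  | Inv of nat & algorithm A
  | Equal of nat & nat & (bool -> algorithm A)
  | Query of nat & (A -> algorithm A).

Arguments Return {A} _.

(* Probability that t outputs b when the stack is s and queries are answered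
   by f; coins are fair and samples are uniform, all independent. *)
Fixpoint prob_output (R : realType) (G : finGroupType) (A : Type) (f : G -> A)
    (b : bool) (t : algorithm A) (s : seq G) : R :=
  match t with
  | Return b' => (b' == b)%:R
  | Flip k =>
      2^-1 * (prob_output R f b (k true) s + prob_output R f b (k false) s)
  | Sample k => expect (fun x => prob_output R f b k (x :: s))
  | One k => prob_output R f b k (1%g :: s)
  | Mul i j k => prob_output R f b k ((nth 1 s i * nth 1 s j)%g :: s)
  | Inv i k => prob_output R f b k (((nth 1 s i)^-1)%g :: s)
  | Equal i j k => prob_output R f b (k (nth 1%g s i == nth 1%g s j)) s
  | Query i k => prob_output R f b (k (f (nth 1%g s i))) s
  end.

Definition prob_accept (R : realType) (G : finGroupType) (A : Type)
    (t : algorithm A) (f : G -> A) : R := prob_output R f true t [::].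

Definition prob_reject (R : realType) (G : finGroupType) (A : Type)
    (t : algorithm A) (f : G -> A) : R := prob_output R f false t [::].

(* Worst case, over all coins and samples, of the number of queries to f. *)
Fixpoint max_queries (G : finGroupType) (A : Type) (f : G -> A)
    (t : algorithm A) (s : seq G) : nat :=
  match t with
  | Return _ => 0
  | Flip k => maxn (max_queries f (k true) s) (max_queries f (k false) s)
  | Sample k => \max_(x : G) max_queries f k (x :: s)
  | One k => max_queries f k (1%g :: s)
  | Mul i j k => max_queries f k ((nth 1 s i * nth 1 s j)%g :: s)
  | Inv i k => max_queries f k (((nth 1 s i)^-1)%g :: s)
  | Equal i j k => max_queries f (k (nth 1%g s i == nth 1%g s j)) s
  | Query i k => (max_queries f (k (f (nth 1%g s i))) s).+1
  end.

Definition num_queries (G : finGroupType) (A : Type)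
    (t : algorithm A) (f : G -> A) : nat := max_queries f t [::].

(* T eps is the algorithm run on the proximity parameter eps. *)
Definition is_tester (R : realType) (G : finGroupType)
    (P : (G -> disc R) -> Prop) (T : R -> algorithm (disc R)) : Prop :=
  forall (eps : R) (f : G -> disc R), 0 < eps ->
    (P f -> 2 / 3 <= prob_accept R (T eps) f) /\
    (far_from P eps f -> 2 / 3 <= prob_reject R (T eps) f).

Definition is_one_sided_tester (R : realType) (G : finGroupType)
    (P : (G -> disc R) -> Prop) (T : R -> algorithm (disc R)) : Prop :=
  is_tester P T /\
  forall (eps : R) (f : G -> disc R), 0 < eps -> P f ->
    prob_accept R (T eps) f = 1.

Definition query_complexity_le (R : realType) (G : finGroupType)
    (T : R -> algorithm (disc R)) (q : R -> R) : Prop :=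
  forall (eps : R) (f : G -> disc R), 0 < eps ->
    (num_queries (T eps) f)%:R <= q eps.

(* Main.v *)
(** Sample independent uniform x, y and reject when f (y x y^-1) <> f x.  Let p
    be the probability of this event and p_x its probability for a fixed x.  The
    average g x of f over the conjugates of x is conjugate invariant, and
    |f x - g x| <= 2 p_x because values in the disc are at distance at most 2.
    Hence dist(f, g)^2 <= E p_x^2 <= p, so p >= eps^2 when f is eps-far, and
    O(1/eps^2) independent repetitions suffice. *)
Require Import Defs.
From mathcomp Require Import all_boot all_order all_algebra all_fingroup.
From mathcomp Require Import complex reals ring lra.

Set Implicit Arguments.
Unset Strict Implicit.
Unset Printing Implicit Defensive.

Import Order.TTheory GRing.Theory Num.Theory.
Local Open Scope ring_scope.

Lemma mean_cst (F : numFieldType) (G : finGroupType) (c : F) :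
  #|G|%:R^-1 * \sum_(x : G) c = c.
Proof.
rewrite sumr_const -[c *+ _]mulr_natl mulKf // pnatr_eq0 -lt0n.
by apply/card_gt0P; exists 1%g.
Qed.

Lemma expect_cst (R : realType) (G : finGroupType) (c : R) :
  expect (fun _ : G => c) = c.
Proof. exact: mean_cst. Qed.
Arguments expect_cst {R} G c.

Section Expectation.
Variables (R : realType) (G : finGroupType).
Implicit Types h k : G -> R.

Lemma eq_expect h k : h =1 k -> expect h = expect k.
Proof. by move=> hk; rewrite /expect (eq_bigr _ (fun x _ => hk x)). Qed.

Lemma expectD h k : expect (fun x => h x + k x) = expect h + expect k.
Proof. by rewrite /expect big_split mulrDr. Qed.

Lemma expectZ c h : expect (fun x => c * h x) = c * expect h.
Proof. by rewrite /expect -mulr_sumr mulrCA. Qed.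

Lemma expect1B h : expect (fun x => 1 - h x) = 1 - expect h.
Proof.
by rewrite -[X in X - _](expect_cst G 1) -mulN1r -expectZ -expectD;
  apply: eq_expect => x; rewrite mulN1r.
Qed.

Lemma le_expect h k : (forall x, h x <= k x) -> expect h <= expect k.
Proof.
by move=> hk; rewrite ler_wpM2l ?invr_ge0 ?ler0n // ler_sum.
Qed.

Lemma expect_itv01 h : (forall x, 0 <= h x <= 1) -> 0 <= expect h <= 1.
Proof.
move=> h01; apply/andP; split.
  by rewrite -[leLHS](expect_cst G 0); apply: le_expect => x; case/andP: (h01 x).
by rewrite -[leRHS](expect_cst G 1); apply: le_expect => x; case/andP: (h01 x).
Qed.

End Expectation.

(** This turns an upper bound on the acceptance probability into a lower bound on the rejection
    probability. *)
Lemma prob_output_total (R : realType) (G : finGroupType) (A : Type)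
    (f : G -> A) (t : algorithm A) (s : seq G) :
  prob_output R f true t s + prob_output R f false t s = 1.
Proof.
elim: t s => [[]|k IH|k IH|k IH|i j k IH|i k IH|i j k IH|i k IH] s //=.
- by rewrite addr0.
- by rewrite add0r.
- have := IH true s; have := IH false s; lra.
- rewrite -expectD -[RHS](expect_cst G 1); apply: eq_expect => x; exact: IH.
Qed.

Lemma normc_sum (R : rcfType) (I : Type) (r : seq I) (F : I -> R[i]) :
  Normc.normc (\sum_(i <- r) F i) <= \sum_(i <- r) Normc.normc (F i).
Proof.
elim: r => [|i r IH]; first by rewrite !big_nil Normc.normc0.
by rewrite !big_cons (le_trans (le_normcD _ _)) // lerD2l.
Qed.

Lemma normc_natV (R : rcfType) (n : nat) :
  Normc.normc (n%:R^-1 : R[i]) = n%:R^-1 :> R.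
Proof. by rewrite Normc.normcV normcMn Normc.normc1. Qed.

Lemma normc_mean (R : realType) (G : finGroupType) (F : G -> R[i]) :
  Normc.normc (#|G|%:R^-1 * \sum_x F x) <= expect (fun x => Normc.normc (F x)).
Proof.
by rewrite Normc.normcM normc_natV ler_wpM2l ?invr_ge0 ?ler0n // normc_sum.
Qed.

Lemma normc_val_disc (R : realType) (z : disc R) : Normc.normc (val z) <= 1.
Proof. exact: valP z. Qed.

Lemma normc_ge0 (R : rcfType) (z : R[i]) : 0 <= Normc.normc z.
Proof. by case: z => a b; apply: sqrtr_ge0. Qed.

Section ConjugateAverage.
Variables (R : realType) (G : finGroupType) (f : G -> disc R).

(** By convexity of the disc, the average is an admissible competitor [g] in [far_from]. *)
Lemma conj_avg_disc x :
  Normc.normc (#|G|%:R^-1 * \sum_(y : G) val (f (y * x * y^-1)%g)) <= 1.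
Proof.
apply: le_trans (normc_mean _) _; rewrite -[leRHS](expect_cst G 1).
by apply: le_expect => y; apply: normc_val_disc.
Qed.

Definition conj_avg (x : G) : disc R :=
  exist (fun z : R[i] => Normc.normc z <= 1) _ (conj_avg_disc x).

Lemma conj_avg_invariant : conjugate_invariant conj_avg.
Proof.
move=> x z; apply: val_inj => /=; congr (_ * _).
(* Conjugating the argument by some element only right-translates the averaging variable by it. *)
rewrite [RHS](reindex_inj (mulIg z)); apply: eq_bigr => y _.
by rewrite invMg !mulgA.
Qed.

Definition conj_disagree (x : G) : R :=
  expect (fun y => (f (y * x * y^-1)%g != f x)%:R).

Lemma conj_disagree_itv01 x : 0 <= conj_disagree x <= 1.
Proof. by apply: expect_itv01 => y; rewrite ler0n lern1 leq_b1. Qed.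

Lemma normc_sub_conj_avg x :
  Normc.normc (val (f x) - val (conj_avg x)) <= 2 * conj_disagree x.
Proof.
have -> : val (f x) - val (conj_avg x) =
    #|G|%:R^-1 * \sum_(y : G) (val (f x) - val (f (y * x * y^-1)%g)).
  by rewrite sumrB mulrBr mean_cst.
apply: le_trans (normc_mean _) _; rewrite -expectZ; apply: le_expect => y.
have [->|_] := eqVneq (f (y * x * y^-1)%g) (f x).
  by rewrite subrr Normc.normc0 mulr0.
rewrite (le_trans (le_normcD _ _)) // normcN.
have := normc_val_disc (f x); have := normc_val_disc (f (y * x * y^-1)%g).
by rewrite /=; lra.
Qed.

Lemma dist_conj_avg_sqr : dist f conj_avg ^+ 2 <= expect conj_disagree.
Proof.
rewrite /dist exprMn sqr_sqrtr; last first.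
  by rewrite mulr_ge0 ?invr_ge0 ?ler0n // sumr_ge0 // => x _; rewrite sqr_ge0.
rewrite -expectZ; apply: le_expect => x.
have := normc_sub_conj_avg x; have := normc_ge0 (val (f x) - val (conj_avg x)).
have := conj_disagree_itv01 x.
set a := Normc.normc _; set d := conj_disagree x => /andP[d0 d1] a0 ad.
(* After squaring, the factor 2 cancels the 1/2 in [dist], and [d ^+ 2 <= d] because [d] is a
   probability. *)
have : a ^+ 2 <= (2 * d) ^+ 2 by rewrite ler_sqr ?nnegrE //; lra.
have : d ^+ 2 <= d by rewrite expr2 ler_piMr.
rewrite !exprMn exprVn; lra.
Qed.

Lemma far_conj_disagree (eps : R) : 0 < eps ->
  far_from (@conjugate_invariant R G) eps f -> eps ^+ 2 <= expect conj_disagree.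
Proof.
move=> eps0 /(_ _ conj_avg_invariant) le_eps.
apply: le_trans dist_conj_avg_sqr.
by rewrite ler_sqr // nnegrE ?(le_trans (ltW eps0)) // ltW.
Qed.

End ConjugateAverage.

(* On the stack [:: y * x * y^-1; y * x; y^-1; y; x], position 4 is x. *)
Fixpoint conj_trials (R : realType) (m : nat) : algorithm (disc R) :=
  if m is m'.+1 then
    Sample (Sample (Inv 0 (Mul 1 2 (Mul 0 1
      (Query 0 (fun a => Query 4 (fun b =>
        if a == b then conj_trials R m' else Return false)))))))
  else Return true.

Section Trials.
Variables (R : realType) (G : finGroupType) (f : G -> disc R).

(** Each trial addresses only elements that it has pushed itself, so the stack [s] is irrelevant and
    the trials are independent. *)
Lemma prob_accept_conj_trials m s :
  prob_output R f true (conj_trials R m) s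
  = (1 - expect (conj_disagree f)) ^+ m.
Proof.
elim: m s => [|m IH] s //=.
set q := 1 - _ in IH *.
(* The two nested expectations match the two [Sample] nodes of a trial, so the factor [q ^+ m] of
   the remaining trials can be moved inside both. *)
have qE :
    q = expect (fun x => expect (fun y => 1 - (f (y * x * y^-1)%g != f x)%:R)).
  by rewrite /q -expect1B; apply: eq_expect => x; rewrite expect1B.
rewrite exprSr {2}qE -expectZ; apply: eq_expect => x.
rewrite -expectZ; apply: eq_expect => y.
case: eqP => _ /=; first by rewrite IH subr0 mulr1.
by rewrite subrr mulr0.
Qed.

Lemma num_queries_conj_trials m s :
  (max_queries f (conj_trials R m) s <= 2 * m)%N.
Proof.
elim: m s => [|m IH] s //=.
apply/bigmax_leqP => x _; apply/bigmax_leqP => y _.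
rewrite mulnS add2n !ltnS; case: ifP => // _; exact: IH.
Qed.

End Trials.

Lemma expr_1sub_le (R : realFieldType) (p : R) (m : nat) :
  0 <= p <= 1 -> 2 <= m%:R * p -> (1 - p) ^+ m <= 1 / 3.
Proof.
move=> /andP[p0 p1] mp2.
have bernoulli : (1 - p) ^+ m * (1 + m%:R * p) <= 1.
  elim: m {mp2} => [|m IH]; first by rewrite expr0 mul0r addr0 mulr1.
  (* What remains is [(1 - p) (1 + (m + 1) p) <= 1 + m p], whose two sides differ by
     [(m + 1) p ^+ 2]. *)
  apply: le_trans IH; rewrite exprSr -mulrA ler_wpM2l ?exprn_ge0 ?subr_ge0 //.
  have := ler0n R m; rewrite -natr1; nra.
have := exprn_ge0 m (_ : 0 <= 1 - p); rewrite subr_ge0 => /(_ p1).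
nra.
Qed.

(* For large eps the bound C / eps^2 is below 1, so no query is allowed; nothing
   is eps-far when eps > 1. *)
Definition conj_tester (R : realType) (eps : R) : algorithm (disc R) :=
  if eps <= 1 then conj_trials R (Num.truncn (2 / eps ^+ 2)).+1 else Return true.

Theorem theorem3p1 (R : realType) :
  exists2 C : R, 0 < C &
  forall G : finGroupType,
  exists T : R -> algorithm (disc R),
    is_one_sided_tester (@conjugate_invariant R G) T /\
    query_complexity_le G T (fun eps => C / eps ^+ 2).
Proof.
(* At two queries per trial, there are at most [2 (2 / eps ^+ 2 + 1)] queries, which is at most
   [6 / eps ^+ 2] when [eps <= 1]. *)
exists 6 => // G; exists (@conj_tester R); split; last first.
  move=> eps f eps0; rewrite /conj_tester /num_queries.
  have e2 : 0 < eps ^+ 2 by rewrite exprn_gt0.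
  case: ifP => [eps1|_]; last by rewrite /= divr_ge0 ?ltW.
  apply: le_trans (_ : (2 * (Num.truncn (2 / eps ^+ 2)).+1)%:R <= _).
    by rewrite ler_nat num_queries_conj_trials.
  have : (Num.truncn (2 / eps ^+ 2))%:R <= 2 / eps ^+ 2.
    by rewrite truncn_le divr_ge0 ?ltW.
  have : 1 <= (eps ^+ 2)^-1 by rewrite invf_ge1 // expr_le1 // ltW.
  by rewrite natrM -natr1; lra.
have complete (eps : R) (f : G -> disc R) : conjugate_invariant f ->
    prob_accept R (conj_tester eps) f = 1.
  move=> inv_f; rewrite /prob_accept /conj_tester; case: ifP => // _.
  rewrite prob_accept_conj_trials (eq_expect (k := fun=> 0)).
    by rewrite expect_cst subr0 expr1n.
  move=> x; rewrite /conj_disagree (eq_expect (k := fun=> 0)) ?expect_cst //.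
  by move=> y; rewrite inv_f eqxx.
split=> [eps f eps0|eps f _]; last exact: complete.
split=> [/complete->|far_f]; first by lra.
have p_ge := far_conj_disagree eps0 far_f.
have p01 := expect_itv01 (conj_disagree_itv01 f).
set p := expect _ in p_ge p01.
have e2 : 0 < eps ^+ 2 by rewrite exprn_gt0.
(* Since [eps ^+ 2 <= p <= 1], a far function excludes the branch that accepts without queries. *)
have eps1 : eps <= 1.
  by rewrite -(@expr_le1 _ 2) ?(ltW eps0) // (le_trans p_ge) //; case/andP: p01.
have := prob_output_total R f (conj_tester eps) [::].
rewrite /prob_reject /conj_tester eps1 prob_accept_conj_trials -/p.
set m := _.+1.
(* The successor after truncation ensures that [m] exceeds [2 / eps ^+ 2], whence
   [m p >= m eps ^+ 2 >= 2]. *)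
have m_gt : 2 / eps ^+ 2 < m%:R by rewrite truncnS_gt.
have mp2 : 2 <= m%:R * p.
  apply: le_trans (_ : m%:R * eps ^+ 2 <= _); last by rewrite ler_wpM2l ?ler0n.
  by rewrite -ler_pdivrMr // ltW.
by have := expr_1sub_le p01 mp2; lra.
Qed.
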